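(* Let $n\ge2$. Let $R:\mathbb{Q}(\mathbf{p},\mathbf{q})\to\mathbb{Q}(\mathbf{p},\mathbf{q})$ be the geometric $R$-matrix, let $\tilde R_{\mathbf{x}}:\mathcal{F}'\to\mathcal{F}'$ be the (specialized) cluster $R$-matrix, and let $\iota:\mathbb{Q}(\mathbf{p},\mathbf{q})\to\mathcal{F}'$ be the embedding of fields $$\iota(p_i)=\frac{x_i^-\,x_{i+1}}{x_{i+1}^-\,x_i}X_{(i+1)^-,i},\qquad\iota(q_i)=\frac{x_i\,x_{i+1}^+}{x_{i+1}\,x_i^+}X_{i+1,i^+}\qquad(i\in\mathbb{Z}/n\mathbb{Z}).$$ Then $\iota\circ R=\tilde R_{\mathbf{x}}\circ\iota$.
   Context: All indices are taken in $\mathbb{Z}/n\mathbb{Z}$. Geometric $R$-matrix: $\mathbf{p}=(p_1,\dots,p_n)$, $\mathbf{q}=(q_1,\dots,q_n)$ are commuting indeterminates, $$\kappa_i(\mathbf{p},\mathbf{q})=\sum_{j=0}^{n-1}\prod_{\ell=1}^{j}p_{i-\ell}\prod_{\ell=j+2}^{n}q_{i-\ell},$$ and $R$ is the rational map (field homomorphism) with $R(p_i)=q_i\dfrac{\kappa_{i+1}(\mathbf{p},\mathbf{q})}{\kappa_i(\mathbf{p},\mathbf{q})}$, $R(q_i)=p_i\dfrac{\kappa_i(\mathbf{p},\mathbf{q})}{\kappa_{i+1}(\mathbf{p},\mathbf{q})}$. Field $\mathcal{F}'$: the field of rational functions over $\mathbb{Q}$ in the $5n$ indeterminates $x_i^-,x_i,x_i^+,X_{(i+1)^-,i},X_{i+1,i^+}$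 ($i\in\mathbb{Z}/n\mathbb{Z}$). Specialized cluster $R$-matrix (the cluster $R$-matrix with the frozen variables $X_{i,i+1}$, $X_{i,i^-}$, $X_{i^+,i}$ set to $1$): $\tilde R_{\mathbf{x}}:\mathcal{F}'\to\mathcal{F}'$ is the field homomorphism with $\tilde R_{\mathbf{x}}(x_i^\pm)=x_i^\pm$, $\tilde R_{\mathbf{x}}(X_{(i+1)^-,i})=X_{i+1,i^+}$, $\tilde R_{\mathbf{x}}(X_{i+1,i^+})=X_{(i+1)^-,i}$, and $$\tilde R_{\mathbf{x}}(x_i)=\frac{1}{\prod_{h\ne i}x_h}\sum_{l=i}^{i+n-1}x_{l+1}^-\Big(\prod_{h\in(\mathbb{Z}/n\mathbb{Z})\setminus\{l,l+1\}}x_h\Big)x_l^+\Big(\prod_{h=l+1}^{i+n-1}X_{(h+1)^-,h}\Big)\Big(\prod_{h=i+1}^{l}X_{h,(h-1)^+}\Big),$$ where $i,l,h$ in the sum and last two products are integers, reduced mod $n$ when used as indices, and empty products are $1$. *)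

(* Defs.v *)
From HB Require Import structures.
From mathcomp Require Import all_boot all_order all_algebra.
From mathcomp Require Import generic_quotient mpoly ring.

Set Implicit Arguments.
Unset Strict Implicit.
Unset Printing Implicit Defensive.

Import GRing.Theory.
Local Open Scope ring_scope.
Local Open Scope quotient_scope.

Local Notation "x %:F" := (FracField.tofrac x).

(** The unique extension to [{fraction R}] of the injective ring morphism
    [phi]; it is a ring morphism, and [frac_hom phi_inj (x%:F) = phi x]. *)
Definition frac_hom (R : idomainType) (K : fieldType)
    (phi : {rmorphism R -> K}) (phi_inj : injective phi)
    (f : {fraction R}) : K :=
  phi \n_(repr f) / phi \d_(repr f).

Lemma frac_numden (R : idomainType) (f : {fraction R}) :
  f = (\n_(repr f))%:F / (\d_(repr f))%:F.
Proof.
have d0 : (\d_(repr f))%:F != 0 by rewrite tofrac_eq0 denom_ratioP.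
have pi_numden (x : {ratio R}) :
    \pi_{fraction R} x * (\d_x)%:F = (\n_x)%:F :> {fraction R}.
  unlock FracField.tofrac; rewrite -[LHS]FracField.pi_mul.
  apply/eqmodP; rewrite /= /FracField.mulf /FracField.equivf.
  by rewrite !numden_Ratio ?mulf_neq0 ?oner_neq0 ?denom_ratioP // !mulr1 mulrC.
apply: (mulIf d0); rewrite divfK // -pi_numden; congr (_ * _).
by rewrite reprK.
Qed.

Lemma fracP (R : idomainType) (f : {fraction R}) :
  exists a b, b != 0 /\ f = a%:F / b%:F.
Proof.
exists \n_(repr f), \d_(repr f); split; first exact: denom_ratioP.
exact: frac_numden.
Qed.

Lemma subf_div (F : fieldType) (a b c d : F) :
  b != 0 -> d != 0 -> a / b - c / d = (a * d - c * b) / (b * d).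
Proof. by move=> b0 d0; field; rewrite b0 d0. Qed.

Section FracHom.
Variables (R : idomainType) (K : fieldType) (phi : {rmorphism R -> K}).
Hypothesis phi_inj : injective phi.
Local Notation Phi := (frac_hom phi_inj).

Lemma inj_neq0 p : p != 0 -> phi p != 0.
Proof. by apply: contraNneq => p0; apply/eqP/phi_inj; rewrite p0 rmorph0. Qed.

Lemma frac_homE p d : d != 0 -> Phi (p%:F / d%:F) = phi p / phi d.
Proof.
move=> d0; rewrite /frac_hom; set f := p%:F / d%:F.
have e0 := denom_ratioP (repr f).
apply/eqP; rewrite eqr_div ?inj_neq0 // -!rmorphM /=; apply/eqP.
congr (phi _); apply/eqP; rewrite -tofrac_eq !rmorphM /=.
by rewrite -eqr_div ?tofrac_eq0 // -frac_numden.
Qed.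

Lemma frac_hom_tofrac p : Phi p%:F = phi p.
Proof. by have := frac_homE p (oner_neq0 _); rewrite !rmorph1 !divr1. Qed.

Lemma frac_hom_zmod : zmod_morphism Phi.
Proof.
move=> f g; have [a [b [b0 ->]]] := fracP f.
have [c [d [d0 ->]]] := fracP g.
have E : a%:F / b%:F - c%:F / d%:F = (a * d - c * b)%:F / (b * d)%:F.
  by rewrite subf_div ?tofrac_eq0 // rmorphB !rmorphM.
rewrite [X in Phi X]E (frac_homE _ b0) (frac_homE _ d0).
rewrite frac_homE ?mulf_neq0 // subf_div ?inj_neq0 //.
by rewrite rmorphB !rmorphM.
Qed.

Lemma frac_hom_monoid : monoid_morphism Phi.
Proof.
split=> [|f g].
  by rewrite -(rmorph1 (@FracField.tofrac R)) frac_hom_tofrac rmorph1.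
have [a [b [b0 ->]]] := fracP f.
have [c [d [d0 ->]]] := fracP g.
have E : (a%:F / b%:F) * (c%:F / d%:F) = (a * c)%:F / (b * d)%:F.
  by rewrite mulf_div !rmorphM.
rewrite [X in Phi X]E (frac_homE _ b0) (frac_homE _ d0).
by rewrite frac_homE ?mulf_neq0 // mulf_div !rmorphM.
Qed.

HB.instance Definition _ := GRing.isZmodMorphism.Build _ _ Phi frac_hom_zmod.
HB.instance Definition _ := GRing.isMonoidMorphism.Build _ _ Phi
  frac_hom_monoid.

End FracHom.

(** [spec phi y z]: the fraction [y] is defined at the "point" [phi], with
    value [z]. *)
Definition spec (R : idomainType) (K : fieldType) (phi : {rmorphism R -> K})
    (y : {fraction R}) (z : K) : Prop :=
  exists g d, [/\ phi d != 0, y = g%:F / d%:F & z = phi g / phi d].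

Section Spec.
Variables (R : idomainType) (K : fieldType) (phi : {rmorphism R -> K}).
Local Notation spec := (spec phi).

Lemma spec_den d : phi d != 0 -> d%:F != 0.
Proof. by rewrite tofrac_eq0; apply: contraNneq => ->; rewrite rmorph0. Qed.

Lemma spec_tofrac p : spec p%:F (phi p).
Proof.
exists p, 1; split; last by rewrite rmorph1 divr1.
  by rewrite rmorph1 oner_neq0.
by rewrite rmorph1 divr1.
Qed.

Lemma spec0 : spec 0 0.
Proof. by have := spec_tofrac 0; rewrite !rmorph0. Qed.

Lemma spec1 : spec 1 1.
Proof. by have := spec_tofrac 1; rewrite !rmorph1. Qed.

Lemma specD y z y' z' : spec y z -> spec y' z' -> spec (y + y') (z + z').
Proof.
move=> [a [b [b0 -> ->]]] [c [d [d0 -> ->]]].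
exists (a * d + c * b), (b * d); split; first by rewrite rmorphM mulf_neq0.
  by rewrite addf_div ?spec_den // rmorphD !rmorphM.
by rewrite addf_div // rmorphD !rmorphM.
Qed.

Lemma specN y z : spec y z -> spec (- y) (- z).
Proof.
move=> [a [b [b0 -> ->]]]; exists (- a), b.
by split; rewrite // rmorphN mulNr.
Qed.

Lemma specM y z y' z' : spec y z -> spec y' z' -> spec (y * y') (z * z').
Proof.
move=> [a [b [b0 -> ->]]] [c [d [d0 -> ->]]].
exists (a * c), (b * d); split; first by rewrite rmorphM mulf_neq0.
  by rewrite mulf_div !rmorphM.
by rewrite mulf_div !rmorphM.
Qed.

Lemma specV y z : z != 0 -> spec y z -> spec y^-1 z^-1.
Proof.
move=> z0 [a [b [b0 -> Dz]]]; exists b, a; split.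
- by apply: contraNneq z0 => a0; rewrite Dz a0 mul0r.
- by rewrite invf_div.
- by rewrite Dz invf_div.
Qed.

Lemma spec_div y z y' z' :
  z' != 0 -> spec y z -> spec y' z' -> spec (y / y') (z / z').
Proof. by move=> z0 Hy Hy'; apply: specM => //; apply: specV. Qed.

Lemma specX y z k : spec y z -> spec (y ^+ k) (z ^+ k).
Proof.
move=> H; elim: k => [|k IH]; first by rewrite !expr0; apply: spec1.
by rewrite !exprS; apply: specM.
Qed.

Lemma spec_sum (I : Type) r (P : pred I) F G :
  (forall i, spec (F i) (G i)) ->
  spec (\sum_(i <- r | P i) F i) (\sum_(i <- r | P i) G i).
Proof. by move=> H; elim/big_rec2: _ => [|*]; [apply: spec0|apply: specD]. Qed.

Lemma spec_prod (I : Type) r (P : pred I) F G :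
  (forall i, spec (F i) (G i)) ->
  spec (\prod_(i <- r | P i) F i) (\prod_(i <- r | P i) G i).
Proof. by move=> H; elim/big_rec2: _ => [|*]; [apply: spec1|apply: specM]. Qed.

Lemma spec0_eq z : spec 0 z -> z = 0.
Proof.
move=> [a [b [b0 /esym/eqP + ->]]].
rewrite mulf_eq0 invr_eq0 (negbTE (spec_den b0)) orbF tofrac_eq0 => /eqP->.
by rewrite rmorph0 mul0r.
Qed.

Lemma spec_neq0 y z : spec y z -> z != 0 -> y != 0.
Proof.
by move=> Hy; apply: contraNneq => y0; apply/eqP/spec0_eq; rewrite -y0.
Qed.

Lemma spec_neq y z y' z' : spec y z -> spec y' z' -> z != z' -> y != y'.
Proof.
rewrite -[z == _]subr_eq0 -[y == _]subr_eq0 => Hy Hy'.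
by apply: spec_neq0; apply: specD => //; apply: specN.
Qed.

End Spec.

Notation ratfun T := {fraction {mpoly rat[#|T|]}}.

Definition var (T : finType) (t : T) : ratfun T :=
  FracField.tofrac 'X_(enum_rank t).

Definition polysubst (T U : finType) (v : T -> ratfun U) :
    {rmorphism {mpoly rat[#|T|]} -> ratfun U} :=
  mmap (@FracField.tofrac {mpoly rat[#|U|]} \o @mpolyC #|U| rat)
       (v \o enum_val).

Definition alg_indep (T U : finType) (v : T -> ratfun U) : Prop :=
  injective (polysubst v).

(** The field homomorphism [ratfun T -> ratfun U] sending [var t] to [v t]. *)
Definition ratsubst (T U : finType) (v : T -> ratfun U) (hv : alg_indep v) :
    {rmorphism ratfun T -> ratfun U} :=
  frac_hom hv.

Lemma polysubst_var (T U : finType) (v : T -> ratfun U) t :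
  polysubst v 'X_(enum_rank t) = v t.
Proof. by rewrite /polysubst /= mmapX mmap1U /= enum_rankK. Qed.

Lemma ratsubst_var (T U : finType) (v : T -> ratfun U) (hv : alg_indep v) t :
  ratsubst hv (var t) = v t.
Proof. by rewrite [LHS]frac_hom_tofrac polysubst_var. Qed.

Lemma polysubst_id (T : finType) p : polysubst (@var T) p = p%:F.
Proof.
rewrite /polysubst /= [p in RHS]mpolyE rmorph_sum /=; apply: eq_bigr => m _.
rewrite -mul_mpolyC rmorphM /=; congr (_ * _).
rewrite mpolyXE_id rmorph_prod /=; apply: eq_bigr => i _.
by rewrite rmorphXn /= /var enum_valK.
Qed.

Lemma var_indep (T : finType) : alg_indep (@var T).
Proof.
move=> p q; rewrite !polysubst_id => /eqP.
by rewrite tofrac_eq => /eqP.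
Qed.

Lemma spec_var (U V : finType) (w : U -> ratfun V) t :
  spec (polysubst w) (var t) (w t).
Proof.
by have := spec_tofrac (polysubst w) 'X_(enum_rank t); rewrite polysubst_var.
Qed.

Lemma alg_indep_spec (T U V : finType) (v : T -> ratfun U)
    (w : U -> ratfun V) (u : T -> ratfun V) :
  alg_indep u -> (forall t, spec (polysubst w) (v t) (u t)) -> alg_indep v.
Proof.
move=> hu H; have Hp p : spec (polysubst w) (polysubst v p) (polysubst u p).
  apply: spec_sum => m; apply: specM.
    have := spec_tofrac (polysubst w) (p@_m)%:MP.
    by rewrite /polysubst /= mmapC.
  by apply: spec_prod => i; apply: specX; apply: H.
apply: raddf_inj => p /eqP p0; apply/eqP; apply: contraLR p0 => p0.
by apply: (spec_neq0 (Hp p)); apply: (inj_neq0 hu).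
Qed.

Section Cyclic.
Variables (n : nat) (hn : (1 < n)%N).
Implicit Types i : 'Z_n.

Lemma natn0 : n%:R = 0 :> 'Z_n. Proof. exact: pchar_Zp. Qed.

Lemma prod_cycle (K : comNzRingType) (F : 'Z_n -> K) i :
  \prod_(0 <= k < n) F (i + k%:R) = \prod_h F h.
Proof.
case: n hn F i => [|[|m]] // _ F i; rewrite big_mkord [RHS](reindex_inj (addrI i)).
by apply: eq_bigr => k _; rewrite natr_Zp.
Qed.

Lemma prod_cycleN (K : comNzRingType) (F : 'Z_n -> K) i :
  \prod_(1 <= k < n.+1) F (i - k%:R) = \prod_h F h.
Proof.
rewrite big_add1 big_nat_rev /= -(prod_cycle F i).
apply: eq_big_nat => k /andP[_ kn]; rewrite add0n subnSK //; congr (F (i + _)).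
by rewrite natrB ?natn0 ?sub0r ?opprK // ltnW.
Qed.

Lemma cyclic_recur_eq0 (K : fieldType) (a b d : 'Z_n -> K) :
  \prod_h a h != \prod_h b h ->
  (forall i, a i * d (i + 1) = b i * d i) -> forall i, d i = 0.
Proof.
move=> ab H i.
have H2 k : (\prod_(0 <= j < k) a (i + j%:R)) * d (i + k%:R) =
            (\prod_(0 <= j < k) b (i + j%:R)) * d i.
  elim: k => [|k IH]; first by rewrite !big_nil addr0.
  rewrite !big_nat_recr //= -natr1 addrA -mulrA H mulrCA IH.
  by rewrite mulrA [b _ * _]mulrC.
have := H2 n; rewrite !prod_cycle natn0 addr0 => /eqP.
by rewrite -subr_eq0 -mulrBl mulf_eq0 subr_eq0 (negbTE ab) => /eqP.
Qed.

End Cyclic.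

Definition pq_index (n : nat) : finType := ('Z_n + 'Z_n)%type.

Definition pvar (n : nat) (i : 'Z_n) : ratfun (pq_index n) :=
  @var (pq_index n) (inl i).
Definition qvar (n : nat) (i : 'Z_n) : ratfun (pq_index n) :=
  @var (pq_index n) (inr i).

Definition kappa (n : nat) (K : comNzRingType) (a b : 'Z_n -> K) (i : 'Z_n) :
    K :=
  \sum_(0 <= j < n) (\prod_(1 <= l < j.+1) a (i - l%:R)) *
                    (\prod_(j.+2 <= l < n.+1) b (i - l%:R)).

Definition geomR_gen (n : nat) (t : pq_index n) : ratfun (pq_index n) :=
  match t with
  | inl i => qvar i * (kappa (@pvar n) (@qvar n) (i + 1) / kappa (@pvar n) (@qvar n) i)
  | inr i => pvar i * (kappa (@pvar n) (@qvar n) i / kappa (@pvar n) (@qvar n) (i + 1))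
  end.

Lemma kappa_recur (n : nat) (hn : (1 < n)%N) (K : comNzRingType)
    (a b : 'Z_n -> K) i :
  b i * kappa a b (i + 1) + \prod_h a h = \prod_h b h + a i * kappa a b i.
Proof.
have shl F : \prod_(1 <= l < n.+1) F (i - l%:R) = \prod_h F h :> K.
  exact: prod_cycleN.
rewrite -(shl a) -(shl b) /kappa {shl}.
case: n hn a b i => // m hm a b i; set N := m.+1.
have N0 : N%:R = 0 :> 'Z_N by apply: natn0.
have stepb u : \prod_(u.+2 <= l < N.+1) b (i + 1 - l%:R) =
               \prod_(u.+1 <= l < N) b (i - l%:R) :> K.
  rewrite big_add1 /=; apply: eq_bigr => l _; congr b.
  by rewrite -natr1 opprD addrACA subrr addr0.
have stepa u : \prod_(1 <= l < u.+2) a (i + 1 - l%:R) =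
               a i * \prod_(1 <= l < u.+1) a (i - l%:R) :> K.
  rewrite big_nat_recl //= addrK; congr (_ * _).
  by apply: eq_bigr => l _; rewrite -natr1 opprD addrACA subrr addr0.
rewrite [X in b i * X]big_nat_recl // [X in _ = _ + _ * X]big_nat_recr //=.
rewrite [\prod_(1 <= _ < 1) _]big_geq // mul1r stepb.
have bN : \prod_(1 <= l < N.+1) b (i - l%:R) =
          b i * \prod_(1 <= l < N) b (i - l%:R).
  by rewrite [LHS]big_nat_recr //= N0 subr0 mulrC.
have aN : \prod_(1 <= l < N.+1) a (i - l%:R) =
          a i * \prod_(1 <= l < N) a (i - l%:R).
  by rewrite [LHS]big_nat_recr //= N0 subr0 mulrC.
rewrite aN bN [\prod_(m.+2 <= _ < _) _]big_geq // mulr1 !mulrDr -!addrA.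
congr (_ + _); congr (_ + _); rewrite !mulr_sumr; apply: eq_big_nat => j.
move=> /andP[_ jm]; rewrite stepa stepb.
rewrite [X in _ = _ * (_ * X)]big_nat_recr //= N0 subr0; ring.
Qed.

Lemma natr_ratfun_neq0 (T : finType) m : (0 < m)%N -> m%:R != 0 :> ratfun T.
Proof.
move=> m0; rewrite -(rmorph_nat (@FracField.tofrac {mpoly rat[#|T|]})).
rewrite tofrac_eq0 -(rmorph_nat (@mpolyC #|T| rat)) mpolyC_eq0.
by rewrite Num.Theory.pnatr_eq0 -lt0n.
Qed.

Lemma recur_diff (K : comNzRingType) (a b c d s t : K) :
  a + t = s + b -> c + s = t + d -> a - d = b - c.
Proof.
move=> /(canRL (addrK _)) -> /esym/(canRL (addKr _)) ->; ring.
Qed.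

Lemma mul_div_cancel (K : fieldType) (x k l : K) :
  k != 0 -> l != 0 -> x = x * (k / l) * (l / k).
Proof. by move=> k0 l0; field; rewrite k0 l0. Qed.

Section GeometricRIndep.
Variables (n : nat) (hn : (1 < n)%N).
Local Notation p := (@pvar n).
Local Notation q := (@qvar n).
Local Notation pR i := (@geomR_gen n (inl i)).
Local Notation qR i := (@geomR_gen n (inr i)).

Lemma spec_kappa (R : idomainType) (K : fieldType) (phi : {rmorphism R -> K})
    a b a' b' (i : 'Z_n) :
  (forall j, spec phi (a j) (a' j)) -> (forall j, spec phi (b j) (b' j)) ->
  spec phi (kappa a b i) (kappa a' b' i).
Proof. by move=> Ha Hb; apply: spec_sum => j; apply: specM; apply: spec_prod. Qed.

Lemma kappa_neq0 (i : 'Z_n) : kappa p q i != 0.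
Proof.
pose w (t : pq_index n) : ratfun (pq_index n) := 1.
have H : spec (polysubst w) (kappa p q i) (kappa (fun=> 1) (fun=> 1) i).
  by apply: spec_kappa => j; apply: spec_var.
apply: (spec_neq0 H); rewrite /kappa.
under eq_bigr do rewrite !big1 // mulr1.
by rewrite big_const_nat subn0 iter_addr_0 natr_ratfun_neq0 // ltnW.
Qed.

Lemma prod_pq_neq : \prod_i p i != \prod_i q i.
Proof.
pose w (t : pq_index n) : ratfun (pq_index n) := if t is inl _ then 1 else 0.
have Hp : spec (polysubst w) (\prod_i p i) (\prod_(i : 'Z_n) 1).
  by apply: spec_prod => i; apply: spec_var.
have Hq : spec (polysubst w) (\prod_i q i) (\prod_(i : 'Z_n) 0).
  by apply: spec_prod => i; apply: spec_var.
apply: (spec_neq Hp Hq); rewrite big1 // (bigD1 (0 : 'Z_n)) //= mul0r.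
exact: oner_neq0.
Qed.

Lemma kappa_geomR (i : 'Z_n) :
  kappa (fun i => pR i) (fun i => qR i) i = kappa p q i.
Proof.
have k0 := kappa_neq0.
have Ep : \prod_i pR i = \prod_i q i.
  rewrite big_split /= prodf_div.
  have -> : \prod_i kappa p q (i + 1) = \prod_i kappa p q i.
    by rewrite [RHS](reindex_inj (addIr 1)).
  by rewrite divff ?mulr1 //; apply/prodf_neq0.
have Eq : \prod_i qR i = \prod_i p i.
  rewrite big_split /= prodf_div.
  have -> : \prod_i kappa p q (i + 1) = \prod_i kappa p q i.
    by rewrite [RHS](reindex_inj (addIr 1)).
  by rewrite divff ?mulr1 //; apply/prodf_neq0.
apply/eqP; rewrite -subr_eq0; apply/eqP; move: i.
apply: (@cyclic_recur_eq0 n hn _ (fun i => qR i) (fun i => pR i)) => [|i].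
  by rewrite Ep Eq prod_pq_neq.
have H1 := kappa_recur hn (fun i => pR i) (fun i => qR i) i.
have H2 := kappa_recur hn p q i.
rewrite Ep Eq in H1.
have qk : qR i * kappa p q (i + 1) = p i * kappa p q i.
  by rewrite /geomR_gen -mulrA divfK.
have pk : pR i * kappa p q i = q i * kappa p q (i + 1).
  by rewrite /geomR_gen -mulrA divfK.
by rewrite !mulrBr qk pk; apply: recur_diff H1 H2.
Qed.

Lemma geomR_indep : alg_indep (@geomR_gen n).
Proof.
have k0 := kappa_neq0.
have Sk i : spec (polysubst (@geomR_gen n)) (kappa p q i) (kappa p q i).
  by rewrite -[X in spec _ _ X]kappa_geomR; apply: spec_kappa => j; apply: spec_var.
have H := spec_var (@geomR_gen n).
apply: (alg_indep_spec (@var_indep _) (w := @geomR_gen n)) => -[i|i].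
  have -> : var (inl i) = qR i * (kappa p q (i + 1) / kappa p q i).
    exact: mul_div_cancel.
  exact: specM (H (inr i)) (spec_div (k0 _) (Sk _) (Sk _)).
have -> : var (inr i) = pR i * (kappa p q i / kappa p q (i + 1)).
  exact: mul_div_cancel.
exact: specM (H (inl i)) (spec_div (k0 _) (Sk _) (Sk _)).
Qed.
End GeometricRIndep.

Definition geomR (n : nat) (hn : (1 < n)%N) :
    {rmorphism ratfun (pq_index n) -> ratfun (pq_index n)} :=
  ratsubst (geomR_indep hn).

(** [IXminus i] indexes $X_{(i+1)^-,i}$ and [IXplus i] indexes $X_{i+1,i^+}$. *)
Variant x_index_type (n : nat) : Type :=
  | Ixminus of 'Z_n | Ix of 'Z_n | Ixplus of 'Z_n
  | IXminus of 'Z_n | IXplus of 'Z_n.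
Arguments Ixminus {n} _.
Arguments Ix {n} _.
Arguments Ixplus {n} _.
Arguments IXminus {n} _.
Arguments IXplus {n} _.

Definition x_index_code (n : nat) (t : x_index_type n) :
    'Z_n + 'Z_n + 'Z_n + 'Z_n + 'Z_n :=
  match t with
  | Ixminus i => inl (inl (inl (inl i)))
  | Ix i => inl (inl (inl (inr i)))
  | Ixplus i => inl (inl (inr i))
  | IXminus i => inl (inr i)
  | IXplus i => inr i
  end.

Definition x_index_decode (n : nat) (t : 'Z_n + 'Z_n + 'Z_n + 'Z_n + 'Z_n) :
    x_index_type n :=
  match t with
  | inl (inl (inl (inl i))) => Ixminus i
  | inl (inl (inl (inr i))) => Ix i
  | inl (inl (inr i)) => Ixplus i
  | inl (inr i) => IXminus i
  | inr i => IXplus i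
  end.

Lemma x_index_codeK n : cancel (@x_index_code n) (@x_index_decode n).
Proof. by case. Qed.

HB.instance Definition _ n := Finite.copy (x_index_type n)
  (can_type (@x_index_codeK n)).

Definition x_index (n : nat) : finType := x_index_type n.

Section Generators.
Variables (n : nat) (i : 'Z_n).
Definition xminus : ratfun (x_index n) := @var (x_index n) (Ixminus i).
Definition xmid : ratfun (x_index n) := @var (x_index n) (Ix i).
Definition xplus : ratfun (x_index n) := @var (x_index n) (Ixplus i).
Definition Xminus : ratfun (x_index n) := @var (x_index n) (IXminus i).
Definition Xplus : ratfun (x_index n) := @var (x_index n) (IXplus i).
End Generators.

(** The integer $i$ of the sum is the representative in $\{0,\dots,n-1\}$;
    since [Xp j] is $X_{j+1,j^+}$, the factor $X_{h,(h-1)^+}$ is [Xp (h - 1)]. *)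
Definition cluster_x (n : nat) (K : fieldType) (xm xo xp Xm Xp : 'Z_n -> K)
    (i : 'Z_n) : K :=
  1 / (\prod_(h : 'Z_n | h != i) xo h) *
  \sum_(i <= l < i + n)
    xm (l%:R + 1) * (\prod_(h : 'Z_n | h \notin [:: l%:R; l%:R + 1]) xo h) *
    xp l%:R *
    (\prod_(l.+1 <= h < i + n) Xm h%:R) *
    (\prod_(i.+1 <= h < l.+1) Xp (h%:R - 1)).

Definition clusterR_gen (n : nat) (t : x_index n) : ratfun (x_index n) :=
  match t with
  | Ixminus i => xminus i
  | Ix i =>
      cluster_x (@xminus n) (@xmid n) (@xplus n) (@Xminus n) (@Xplus n) i
  | Ixplus i => xplus i
  | IXminus i => Xplus i
  | IXplus i => Xminus i
  end.

Section ClusterIndep.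
Variables (n : nat) (hn : (1 < n)%N).

Definition cluster_sum (K : comNzRingType) (c M M' : 'Z_n -> K) (i : 'Z_n) :=
  \sum_(0 <= k < n) c (i + k%:R) * (\prod_(k.+1 <= h < n) M (i + h%:R)) *
    \prod_(0 <= h < k) M' (i + h%:R).

Lemma cluster_sum_recur (K : comNzRingType) (c M M' : 'Z_n -> K) (i : 'Z_n) :
  M' i * cluster_sum c M M' (i + 1) + c i * \prod_h M h =
  M i * cluster_sum c M M' i + c i * \prod_h M' h.
Proof.
pose G k := c (i + k%:R) * (\prod_(k.+1 <= h < n.+1) M (i + h%:R)) *
    \prod_(0 <= h < k) M' (i + h%:R).
have nz : n%:R = 0 :> 'Z_n by apply: natn0.
have n0 : (0 < n)%N by apply: ltnW.
have E1 : M' i * cluster_sum c M M' (i + 1) = \sum_(0 <= k < n) G k.+1.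
  rewrite mulr_sumr; apply: eq_big_nat => k _; 
  rewrite /G [\prod_(0 <= _ < k.+1) _]big_nat_recl // [in RHS]big_add1 /= addr0.
  rewrite -nat1r addrA [RHS]mulrCA; congr (_ * (_ * _ * _)).
    by apply: eq_bigr => h _; rewrite -nat1r addrA.
  by apply: eq_bigr => h _; rewrite -nat1r addrA.
have E2 : M i * cluster_sum c M M' i = \sum_(0 <= k < n) G k.
  rewrite mulr_sumr; apply: eq_big_nat => k /andP[_ kn].
  by rewrite /G [\prod_(k.+1 <= _ < n.+1) _]big_nat_recr //= nz addr0; ring.
have G0 : c i * \prod_h M h = G 0%N.
  rewrite /G big_nil mulr1 addr0 big_add1 -(prod_cycle hn M (i + 1)).
  by congr (_ * _); apply: eq_bigr => h _; rewrite -nat1r addrA.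
have Gn : c i * \prod_h M' h = G n.
  by rewrite /G nz addr0 [\prod_(n.+1 <= _ < _) _]big_geq // mulr1 prod_cycle.
by rewrite E1 E2 G0 Gn -big_nat_recr // addrC -big_nat_recl.
Qed.

Lemma cluster_xE (K : fieldType) (y z y' M M' : 'Z_n -> K) (i : 'Z_n) :
  (forall j, z j != 0) ->
  cluster_x y z y' M M' i =
  z i * cluster_sum (fun l => y (l + 1) * y' l / (z l * z (l + 1))) M M' i.
Proof.
move=> z0; rewrite /cluster_x /cluster_sum.
have P1 : \prod_h z h = z i * \prod_(h | h != i) z h by rewrite (bigD1 i).
have P2 l : \prod_h z h =
    z l * (z (l + 1) * \prod_(h | h \notin [:: l; l + 1]) z h).
  rewrite (bigD1 l) //= (bigD1 (l + 1)) /=; last first.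
    by rewrite -subr_eq0 addrC addKr oner_neq0.
  by congr (_ * (_ * _)); apply: eq_bigl => h; rewrite !inE negb_or.
have Q0 : \prod_(h | h != i) z h != 0 by apply/prodf_neq0.
rewrite !mulr_sumr -{1}[i : nat]add0n big_addn addnC addnK.
apply: eq_big_nat => k /andP[_ kn].
have -> : (k + i)%:R = i + k%:R :> 'Z_n by rewrite natrD natr_Zp addrC.
rewrite -!mulrA !mulrA; congr (_ * _ * _).
- have := P2 (i + k%:R); rewrite P1; set Q := \prod_(h | h != i) _.
  set T := \prod_(h | h \notin _) _ => E.
  have -> : T = z i * Q / (z (i + k%:R) * z (i + k%:R + 1)).
    by rewrite E mulrA [_ * _ * T]mulrC mulfK // mulf_neq0.
  by field; rewrite !z0 Q0.
- rewrite -[in LHS]addSn big_addn addnK.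
  by apply: eq_bigr => h _; rewrite natrD natr_Zp addrC.
rewrite -[i.+1]add1n -addSn big_addn addnK big_add1 /=.
by apply: eq_bigr => h _; rewrite natrD natr_Zp -natr1 addrAC addrK addrC.
Qed.

Local Notation y := (@xminus n).
Local Notation z := (@xmid n).
Local Notation y' := (@xplus n).
Local Notation M := (@Xminus n).
Local Notation M' := (@Xplus n).
Local Notation E i := (@clusterR_gen n (Ix i)).

Lemma spec_cluster_x (R : idomainType) (K : fieldType)
    (phi : {rmorphism R -> K}) a b c d e a' b' c' d' e' (i : 'Z_n) :
  (forall j, b' j != 0) ->
  (forall j, spec phi (a j) (a' j)) -> (forall j, spec phi (b j) (b' j)) ->
  (forall j, spec phi (c j) (c' j)) -> (forall j, spec phi (d j) (d' j)) ->
  (forall j, spec phi (e j) (e' j)) ->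
  spec phi (cluster_x a b c d e i) (cluster_x a' b' c' d' e' i).
Proof.
move=> b0 Ha Hb Hc Hd He; apply: specM.
  apply: spec_div; [exact/prodf_neq0 | exact: spec1 | exact: spec_prod].
apply: spec_sum => l.
by do !apply: specM => //; apply: spec_prod.
Qed.

Lemma var_neq0 (T : finType) (t : T) : var t != 0.
Proof.
apply: (spec_neq0 (spec_var (fun=> 1 : ratfun T) t)); exact: oner_neq0.
Qed.

Lemma clusterE_neq0 (i : 'Z_n) : E i != 0.
Proof.
pose w (t : x_index n) : ratfun (x_index n) := 1.
pose o (j : 'Z_n) : ratfun (x_index n) := 1.
have H : spec (polysubst w) (E i) (cluster_x o o o o o i).
  apply: spec_cluster_x => j; try exact: spec_var.
  exact: oner_neq0.
apply: (spec_neq0 H); rewrite cluster_xE => [|j]; last exact: oner_neq0.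
rewrite /cluster_sum mul1r.
under eq_bigr do rewrite !big1 // !mulr1 divr1.
by rewrite big_const_nat subn0 iter_addr_0 natr_ratfun_neq0 // ltnW.
Qed.

Lemma prod_X_neq : \prod_i M i != \prod_i M' i.
Proof.
pose w (t : x_index n) : ratfun (x_index n) :=
  if t is IXminus _ then 1 else 0.
have H1 : spec (polysubst w) (\prod_i M i) (\prod_(i : 'Z_n) 1).
  by apply: spec_prod => i; apply: spec_var.
have H2 : spec (polysubst w) (\prod_i M' i) (\prod_(i : 'Z_n) 0).
  by apply: spec_prod => i; apply: spec_var.
apply: (spec_neq H1 H2); rewrite big1 // (bigD1 (0 : 'Z_n)) //= mul0r.
exact: oner_neq0.
Qed.

Lemma cluster_inv_step (K : fieldType) (c m m' t t' s s' a b : K) :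
  s != 0 -> s' != 0 ->
  m' * s' + c * a = m * s + c * b ->
  m * t' + c / (s * s') * b = m' * t + c / (s * s') * a ->
  m * (t' - s'^-1) = m' * (t - s^-1).
Proof.
move=> s0 s1 /(canRL (addrK _)) H /(canRL (addrK _)) H'.
have -> : m' * (t - s^-1) = m' * t - m' * s' / (s * s').
  by field; rewrite s0 s1.
by rewrite mulrBr H H'; field; rewrite s0 s1.
Qed.

Lemma div_mulACA (K : fieldType) (u a b s t : K) :
  u / (a * s * (b * t)) = u / (a * b) / (s * t).
Proof. by rewrite mulrACA invfM mulrA. Qed.

Lemma cluster_x_invol (i : 'Z_n) :
  cluster_x y (fun i => E i) y' M' M i = z i.
Proof.
pose c l := y (l + 1) * y' l / (z l * z (l + 1)).
pose S := cluster_sum c M M'.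
have z0 j : z j != 0 by apply: var_neq0.
have ES j : E j = z j * S j by rewrite /= cluster_xE.
have S0 j : S j != 0.
  by have := clusterE_neq0 j; rewrite ES mulf_eq0 negb_or => /andP[].
rewrite cluster_xE; last exact: clusterE_neq0.
pose c' l := c l / (S l * S (l + 1)).
have -> : cluster_sum (fun l => y (l + 1) * y' l / (E l * E (l + 1))) M' M i =
          cluster_sum c' M' M i.
  apply: eq_big_nat => k _; congr (_ * _ * _); rewrite !ES /c' /c.
  exact: div_mulACA.
suff -> : cluster_sum c' M' M i = (S i)^-1 by rewrite ES mulfK.
apply/eqP; rewrite -subr_eq0; apply/eqP; move: i.
apply: (cyclic_recur_eq0 hn prod_X_neq) => i.
apply: (cluster_inv_step (S0 _) (S0 _) (cluster_sum_recur c M M' i)).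
exact: cluster_sum_recur.
Qed.

Lemma clusterR_indep : alg_indep (@clusterR_gen n).
Proof.
have H := spec_var (@clusterR_gen n).
apply: (alg_indep_spec (@var_indep _) (w := @clusterR_gen n)) => -[] i.
- exact: (H (Ixminus i)).
- rewrite -[X in spec _ _ X]/(z i) -cluster_x_invol; apply: spec_cluster_x => j.
  + exact: clusterE_neq0.
  + exact: (H (Ixminus j)).
  + exact: (H (Ix j)).
  + exact: (H (Ixplus j)).
  + exact: (H (IXminus j)).
  + exact: (H (IXplus j)).
- exact: (H (Ixplus i)).
- exact: (H (IXplus i)).
- exact: (H (IXminus i)).
Qed.

End ClusterIndep.

Definition clusterR (n : nat) (hn : (1 < n)%N) :
    {rmorphism ratfun (x_index n) -> ratfun (x_index n)} :=
  ratsubst (clusterR_indep hn).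

Definition iota_gen (n : nat) (t : pq_index n) : ratfun (x_index n) :=
  match t with
  | inl i => xminus i * xmid (i + 1) / (xminus (i + 1) * xmid i) * Xminus i
  | inr i => xmid i * xplus (i + 1) / (xmid (i + 1) * xplus i) * Xplus i
  end.

Lemma iota_indep (n : nat) : alg_indep (@iota_gen n).
Proof.
pose w (t : x_index n) : ratfun (pq_index n) :=
  match t with IXminus i => pvar i | IXplus i => qvar i | _ => 1 end.
have H := spec_var w.
apply: (alg_indep_spec (@var_indep _) (w := w)) => -[i|i].
  have -> : var (inl i) = 1 * 1 / (1 * 1) * pvar i by rewrite !mulr1 divr1 mul1r.
  apply: specM; last exact: (H (IXminus i)).
  apply: spec_div; first by rewrite mulr1 oner_neq0.
    exact: (specM (H (Ixminus _)) (H (Ix _))).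
  exact: (specM (H (Ixminus _)) (H (Ix _))).
have -> : var (inr i) = 1 * 1 / (1 * 1) * qvar i by rewrite !mulr1 divr1 mul1r.
apply: specM; last exact: (H (IXplus i)).
apply: spec_div; first by rewrite mulr1 oner_neq0.
  exact: (specM (H (Ix _)) (H (Ixplus _))).
exact: (specM (H (Ix _)) (H (Ixplus _))).
Qed.

Definition iota_hom (n : nat) :
    {rmorphism ratfun (pq_index n) -> ratfun (x_index n)} :=
  ratsubst (@iota_indep n).

(* Main.v *)
Require Import Defs.
From mathcomp Require Import all_boot all_order all_algebra.
From mathcomp Require Import mpoly.
From mathcomp Require Import ring.

(** Both composites are field homomorphisms, so they only have to be compared
    on the variables $p_i$ and $q_i$ ([ratfun_hom_ext]).

    Write $a_i = x_i^-/x_i$ and $b_i = x_i^+/x_i$.  Then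
    $\iota(p_i) = (a_i/a_{i+1}) X_{(i+1)^-,i}$ and
    $\iota(q_i) = (b_{i+1}/b_i) X_{i+1,i^+}$: up to two telescoping factors,
    $\iota$ sends the $p_i$ and $q_i$ to the $X$ variables.  On the other side,
    $\tilde R_x(x_i) = x_i S_i$ for the sum $S_i$ = [cluster_sum] with
    coefficients $c_i = a_{i+1} b_i$.  The sequences $S_i$ and
    $\kappa_i(\iota p, \iota q)$ both satisfy a first-order inhomogeneous
    recurrence around the cycle ([cluster_sum_recur], [kappa_recur]).
    Multiplying the recurrence of $\kappa$ by $c_i$ turns it into the one for
    $S$, with $a_i b_i \kappa_i$ in place of $S_i$.  The homogeneous recurrence
    has only the zero solution, because the products of the two families of $X$
    variables over the cycle are different; hence $S_i = a_i b_i \kappa_i$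
    ([cluster_sum_kappa]).

    Therefore $\tilde R_x$ multiplies $x_{i+1}/x_i$ by
    $a_{i+1} b_{i+1} \kappa_{i+1} / (a_i b_i \kappa_i)$.  Its monomial part
    exchanges the telescoping factors of $\iota(p_i)$ and $\iota(q_i)$, just as
    $\tilde R_x$ exchanges the $X$ variables, and the remaining factor
    $\kappa_{i+1}/\kappa_i$, or its inverse, is the one in the definition
    of $R$. *)

Set Implicit Arguments.
Unset Strict Implicit.
Unset Printing Implicit Defensive.

Import GRing.Theory.
Local Open Scope ring_scope.

(** Numerators and denominators are polynomials over the prime field, on which
    all ring morphisms into a given field coincide. *)
Lemma ratfun_hom_ext (T : finType) (K : fieldType)
    (f g : {rmorphism ratfun T -> K}) :
  (forall t, f (var t) = g (var t)) -> f =1 g.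
Proof.
move=> fg.
have fgC (c : rat) :
    f (FracField.tofrac c%:MP_[#|T|]) = g (FracField.tofrac c%:MP_[#|T|]).
  pose emb := @FracField.tofrac {mpoly rat[#|T|]} \o @mpolyC #|T| rat.
  have -> : FracField.tofrac c%:MP_[#|T|] = ratr c.
    by rewrite -(fmorph_eq_rat emb).
  by rewrite !fmorph_rat.
have fgP p : f (FracField.tofrac p) = g (FracField.tofrac p).
  rewrite [p]mpolyE !rmorph_sum /=; apply: eq_bigr => m _.
  rewrite -mul_mpolyC !rmorphM /= fgC; congr (_ * _).
  rewrite mpolyXE_id !rmorph_prod /=; apply: eq_bigr => i _.
  by rewrite !rmorphXn /=; have := fg (enum_val i); rewrite /var enum_valK => ->.
move=> x; have [p [d [d0 ->]]] := fracP x.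
by rewrite !fmorph_div !fgP.
Qed.

Lemma rmorph_kappa (n : nat) (K L : comNzRingType) (f : {rmorphism K -> L})
    (a b : 'Z_n -> K) (i : 'Z_n) :
  f (kappa a b i) = kappa (f \o a) (f \o b) i.
Proof.
rewrite rmorph_sum; apply: eq_bigr => j _.
by rewrite rmorphM !rmorph_prod.
Qed.

Section KappaClusterSum.
Variables (n : nat) (hn : (1 < n)%N) (K : fieldType).

Lemma prod_telescope (a M : 'Z_n -> K) :
  (forall j, a j != 0) -> \prod_j (a j / a (j + 1) * M j) = \prod_j M j.
Proof.
move=> a0; rewrite big_split /= prodf_div.
have -> : \prod_j a (j + 1) = \prod_j a j by rewrite [RHS](reindex_inj (addIr 1)).
by rewrite divff ?mul1r //; apply/prodf_neq0.
Qed.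

(** The monomials $a_i b_i$ intertwine the recurrences of the two families,
    and these recurrences have at most one solution around the cycle. *)
Lemma cluster_sum_kappa (a b M M' : 'Z_n -> K) :
  (forall j, a j != 0) -> (forall j, b j != 0) ->
  \prod_j M j != \prod_j M' j ->
  forall i,
  cluster_sum (fun j => a (j + 1) * b j) M M' i =
  a i * b i * kappa (fun j => a j / a (j + 1) * M j)
                    (fun j => b (j + 1) / b j * M' j) i.
Proof.
move=> a0 b0 MM' i; set P := fun j => a j / _ * _; set Q := fun j => b _ / _ * _.
have EP : \prod_j P j = \prod_j M j by apply: prod_telescope.
have EQ : \prod_j Q j = \prod_j M' j.
  rewrite -[RHS](@prod_telescope (fun j => (b j)^-1)) => [|j].
    by apply: eq_bigr => j _; rewrite invrK [_^-1 * _]mulrC.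
  by rewrite invr_eq0.
apply/eqP; rewrite -subr_eq0; apply/eqP; move: i.
apply: (cyclic_recur_eq0 hn (a := M') (b := M)) => [|i]; first by rewrite eq_sym.
(* It remains to compare the recurrence of the cluster sum with the one of
   kappa scaled by the coefficient a_(i+1) b_i of the cluster sum. *)
have HS := cluster_sum_recur hn (fun j => a (j + 1) * b j) M M' i.
have HK : a (i + 1) * b i * (Q i * kappa P Q (i + 1) + \prod_j P j) =
          a (i + 1) * b i * (\prod_j Q j + P i * kappa P Q i).
  by rewrite (kappa_recur hn).
rewrite EP EQ !mulrDr in HK.
have HQ k : a (i + 1) * b i * (Q i * k) = M' i * (a (i + 1) * b (i + 1) * k).
  by rewrite /Q; field; rewrite b0.
have HP k : a (i + 1) * b i * (P i * k) = M i * (a i * b i * k).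
  by rewrite /P; field; rewrite a0.
rewrite HQ HP [X in _ = X]addrC in HK.
rewrite !mulrBr; apply/eqP; rewrite subr_eq addrAC eq_sym subr_eq; apply/eqP.
apply: (addIr (a (i + 1) * b i * \prod_j M' j)).
by rewrite addrAC -HS addrAC -addrA HK addrA.
Qed.

End KappaClusterSum.

Section MonomialImages.
Variables (n : nat) (hn : (1 < n)%N) (K : fieldType).
Variables (y z y' M M' : 'Z_n -> K).
Hypotheses (y0 : forall j, y j != 0) (z0 : forall j, z j != 0).
Hypotheses (y'0 : forall j, y' j != 0) (MM' : \prod_j M j != \prod_j M' j).

Local Notation P := (fun j => y j * z (j + 1) / (y (j + 1) * z j) * M j).
Local Notation Q := (fun j => z j * y' (j + 1) / (z (j + 1) * y' j) * M' j).
Local Notation E := (cluster_x y z y' M M').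
Local Notation k := (kappa P Q).

(** With $z = x$, $y = x^-$ and $y' = x^+$, the factor $y_i y'_i/z_i$ is
    $z_i a_i b_i$ for the ratios $a = y/z$ and $b = y'/z$. *)
Lemma cluster_x_kappa (i : 'Z_n) : E i = y i * y' i / z i * k i.
Proof.
pose a j := y j / z j; pose b j := y' j / z j.
have a0 j : a j != 0 by rewrite mulf_neq0 ?invr_eq0.
have b0 j : b j != 0 by rewrite mulf_neq0 ?invr_eq0.
rewrite cluster_xE //.
have -> : cluster_sum (fun l => y (l + 1) * y' l / (z l * z (l + 1))) M M' i =
          cluster_sum (fun j => a (j + 1) * b j) M M' i.
  apply: eq_bigr => j _; congr (_ * _ * _).
  by rewrite [z _ * _]mulrC mulf_div.
rewrite (cluster_sum_kappa hn a0 b0 MM').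
have -> : k i = kappa (fun j => a j / a (j + 1) * M j)
                      (fun j => b (j + 1) / b j * M' j) i.
  apply: eq_bigr => j _; congr (_ * _); apply: eq_bigr => l _.
    by congr (_ * _); rewrite /a; field; rewrite !z0 y0.
  by congr (_ * _); rewrite /b; field; rewrite !z0 y'0.
by rewrite mulrA; congr (_ * _); rewrite /a /b; field; rewrite z0.
Qed.

Hypothesis k0 : forall j, k j != 0.

(** The next two identities are the theorem on the generators $p_i$ and $q_i$,
    read in any field: replacing each $z_i$ by [E i] and exchanging [M] with
    [M'] in [P i] has the effect of the geometric $R$-matrix on [P i], and
    likewise for [Q i].  Over an abstract field they reduce to cancellation of
    monomials. *)
Lemma cluster_x_image_p (i : 'Z_n) :
  y i * E (i + 1) / (y (i + 1) * E i) * M' i = Q i * (k (i + 1) / k i).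
Proof. by rewrite !cluster_x_kappa; field; rewrite !y0 !z0 !y'0 !k0. Qed.

Lemma cluster_x_image_q (i : 'Z_n) :
  E i * y' (i + 1) / (E (i + 1) * y' i) * M i = P i * (k i / k (i + 1)).
Proof. by rewrite !cluster_x_kappa; field; rewrite !y0 !z0 !y'0 !k0. Qed.

End MonomialImages.

Lemma iota_kappa (n : nat) (i : 'Z_n) :
  iota_hom n (kappa (@pvar n) (@qvar n) i) =
  kappa (fun j => @iota_gen n (inl j)) (fun j => iota_gen (inr j)) i.
Proof.
rewrite rmorph_kappa; apply: eq_bigr => k _.
by congr (_ * _); apply: eq_bigr => l _; apply: ratsubst_var.
Qed.

Theorem theorem4p2 (n : nat) (hn : (1 < n)%N) :
  iota_hom n \o geomR hn =1 clusterR hn \o iota_hom n.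
Proof.
have x0 j : @xmid n j != 0 := var_neq0 _.
have xm0 j : @xminus n j != 0 := var_neq0 _.
have xp0 j : @xplus n j != 0 := var_neq0 _.
have k0 j : kappa (fun j => @iota_gen n (inl j)) (fun j => iota_gen (inr j)) j != 0.
  by rewrite -iota_kappa fmorph_eq0 kappa_neq0.
have R_var t : geomR hn (var t) = geomR_gen t := ratsubst_var _ _.
have C_var t : clusterR hn (var t) = clusterR_gen t := ratsubst_var _ _.
have iota_var t : iota_hom n (var t) = iota_gen t := ratsubst_var _ _.
refine (@ratfun_hom_ext (pq_index n) (ratfun (x_index n)) (iota_hom n \o geomR hn)
  (clusterR hn \o iota_hom n) _) => t.
change (iota_hom n (geomR hn (var t)) = clusterR hn (iota_hom n (var t))).
rewrite R_var iota_var; case: t => i.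
  rewrite [in LHS]/geomR_gen [in RHS]/iota_gen.
  rewrite !rmorphM !fmorphV !rmorphM !iota_kappa iota_var !C_var.
  by rewrite [RHS](cluster_x_image_p hn xm0 x0 xp0 (prod_X_neq n) k0).
rewrite [in LHS]/geomR_gen [in RHS]/iota_gen.
rewrite !rmorphM !fmorphV !rmorphM !iota_kappa iota_var !C_var.
by rewrite [RHS](cluster_x_image_q hn xm0 x0 xp0 (prod_X_neq n) k0).
Qed.
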